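(* Let $X$ be a complex Banach space of dimension at least $2$ and let $\mathfrak{N}$ be a subspace lattice in $X$ which is a nest. Then $\mathfrak{N}$ is reflexive, that is, $\operatorname{Lat}\operatorname{Alg}(\mathfrak{N})=\mathfrak{N}$.
   Context: A subspace of $X$ means a closed linear subspace; $\mathfrak{C}(X)$ is the family of all subspaces of $X$. Joins and meets: $\bigvee_j M_j$ is the closed linear span of the $M_j$, $\bigwedge_j M_j=\bigcap_j M_j$, with $\bigvee\emptyset=\{0\}$ and $\bigwedge\emptyset=X$. A subspace lattice in $X$ is a family $\mathfrak{L}\subseteq\mathfrak{C}(X)$ containing $\{0\}$ and $X$ and closed under arbitrary joins and meets. A nest is a subspace lattice totally ordered by inclusion. $\mathcal{B}(X)$ is the algebra of bounded linear operators on $X$. For $\mathfrak{F}\subseteq\mathfrak{C}(X)$, $\operatorname{Alg}(\mathfrak{F})=\{A\in\mathcal{B}(X): AM\subseteq M\text{ for all }M\in\mathfrak{F}\}$; for $\mathcal{T}\subseteq\mathcal{B}(X)$, $\operatorname{Lat}(\mathcal{T})=\{M\in\mathfrak{C}(X): TM\subseteq M\text{ for all }T\in\mathcal{T}\}$. *)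

(* Defs.v *)
(* MathComp-Analysis, with complex scalars R[i] from mathcomp-real-closed. *)
From mathcomp Require Import all_boot all_order all_algebra.
From mathcomp Require Import complex.
From mathcomp Require Import all_classical all_reals all_analysis.

Set Implicit Arguments.
Unset Strict Implicit.
Unset Printing Implicit Defensive.

Import Order.TTheory GRing.Theory Num.Theory.
Import numFieldNormedType.Exports.

Local Open Scope classical_set_scope.
Local Open Scope complex_scope.
Local Open Scope ring_scope.

Definition linearly_independent (K : fieldType) (V : lmodType K) (n : nat)
    (v : 'I_n -> V) : Prop :=
  forall a : 'I_n -> K, \sum_(i < n) a i *: v i = 0 -> forall i, a i = 0.

(* This also holds when V is infinite-dimensional. *)
Definition dim_at_least (K : fieldType) (V : lmodType K) (n : nat) : Prop :=
  exists v : 'I_n -> V, linearly_independent v.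

Definition linear_span (K : fieldType) (V : lmodType K) (S : set V) : set V :=
  [set x | exists (n : nat) (a : 'I_n -> K) (v : 'I_n -> V),
     (forall i, S (v i)) /\ x = \sum_(i < n) a i *: v i].

Section Subspaces.
Variables (R : realType) (X : completeNormedModType R[i]).

Definition closed_subspace (M : set X) : Prop :=
  closed M /\ submod_closed [in M].

(* Families of subspaces are sets of sets, so joins and meets need no separate
   indexing: for the empty family the join is [set 0] and the meet is setT. *)
Definition subspace_join (F : set (set X)) : set X :=
  closure (linear_span (\bigcup_(M in F) M)).

Definition subspace_meet (F : set (set X)) : set X := \bigcap_(M in F) M.

Definition subspace_lattice (L : set (set X)) : Prop :=
  [/\ L `<=` closed_subspace,
      L [set 0],
      L setT,
      forall F, F `<=` L -> L (subspace_join F) &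
      forall F, F `<=` L -> L (subspace_meet F)].

Definition nest (L : set (set X)) : Prop :=
  subspace_lattice L /\ total_on L subset.

Definition bounded_operator : set {linear X -> X} :=
  [set A | exists c : R, forall x, `|A x| <= c%:C * `|x|].

Definition Alg (F : set (set X)) : set {linear X -> X} :=
  [set A | bounded_operator A /\ forall M, F M -> A @` M `<=` M].

Definition Lat (T : set {linear X -> X}) : set (set X) :=
  [set M | closed_subspace M /\ forall A, T A -> A @` M `<=` M].

End Subspaces.

(* Main.v *)
(* Let M be invariant under Alg N and y in M. A rank-one operator z |-> f(z) x
   lies in Alg N as soon as every K in N satisfies f = 0 on K or x \in K; if
   moreover f(y) = 1, then x \in M. Let P be the join of the K in N that do not
   contain y, and N_y the meet of those that do. Taking f = 0 on such a K, f(y) = 1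
   and x in K gives K <= M, hence P <= M. If y \in P then N_y <= P; otherwise take
   f = 0 on P, f(y) = 1 and x in N_y. In both cases y \in N_y <= M, so M is a join
   of members of N.
   The functionals f come from the Hahn-Banach theorem for the seminorm
   dist(., P): a minimal sublinear functional is additive, because straightening
   it in any direction gives a sublinear functional that is not larger. *)
Require Import Defs.
From HB Require Import structures.
From mathcomp Require Import all_boot all_order all_algebra.
From mathcomp Require Import complex.
From mathcomp Require Import all_classical all_reals all_analysis.
From mathcomp Require Import lra.

Set Implicit Arguments.
Unset Strict Implicit.
Unset Printing Implicit Defensive.

Import Order.TTheory GRing.Theory Num.Theory.
Import numFieldNormedType.Exports.

Local Open Scope classical_set_scope.
Local Open Scope complex_scope.
Local Open Scope ring_scope.

(** * The Hahn-Banach theorem for sublinear functionals and seminorms *)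

Section HahnBanach.
Variables (R : realType) (V : lmodType R[i]).
Implicit Types (p q : V -> R) (x y : V).

(** One inequality for t > 0 encodes positive homogeneity: used with t^-1 it gives the reverse one,
    and [sublinear0] gives the case t = 0. *)
Definition sublinear p : Prop :=
  (forall x y, p (x + y) <= p x + p y) /\
  (forall t x, 0 < t -> p (t%:C *: x) <= t * p x).

Lemma sublinear0 p : sublinear p -> p 0 = 0.
Proof.
move=> [pD pZ]; have := pD 0 0; have := pZ 2^-1 0.
by rewrite addr0 scaler0 invr_gt0 ltr0n => /(_ isT); lra.
Qed.

Lemma sublinearN p x : sublinear p -> - p (- x) <= p x.
Proof.
by move=> sp; have := sp.1 x (- x); rewrite subrr sublinear0//; lra.
Qed.

(** The index [k] may depend on the vectors, so that this covers both the infimum over t in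
    [straighten] and the infimum of a chain in Zorn's lemma. *)
Lemma sublinear_inf (I : Type) (D : set I) (F : I -> V -> R) :
  D !=set0 -> (forall x, has_lbound [set F i x | i in D]) ->
  (forall i j x y, D i -> D j ->
     exists2 k, D k & F k (x + y) <= F i x + F j y) ->
  (forall i t x, D i -> 0 < t ->
     exists2 k, D k & F k (t%:C *: x) <= t * F i x) ->
  sublinear (fun x => inf [set F i x | i in D]).
Proof.
move=> [i0 Di0] lb FD FZ.
have Finf_le k x : D k -> inf [set F i x | i in D] <= F k x.
  by move=> Dk; apply: ge_inf => //; exists k.
have le_Finf x a : (forall i, D i -> a <= F i x) -> a <= inf [set F i x | i in D].
  move=> h; apply: lb_le_inf; first by exists (F i0 x), i0.
  by move=> _ [i Di <-]; exact: h.
split=> [x y|t x t0].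
  rewrite -lerBlDr; apply: (le_Finf) => i Di.
  rewrite lerBlDr -lerBlDl; apply: (le_Finf) => j Dj.
  rewrite lerBlDl; have [k Dk] := FD i j x y Di Dj.
  by apply: le_trans; exact: Finf_le.
rewrite mulrC -ler_pdivrMr//; apply: (le_Finf) => i Di.
rewrite ler_pdivrMr// mulrC; have [k Dk] := FZ i t x Di t0.
by apply: le_trans; exact: Finf_le.
Qed.

(* The largest sublinear functional [r <= p] with [r (x + y) = r x + p y]. *)
Definition straighten p y x : R :=
  inf [set p (x + t%:C *: y) - t * p y | t in [set t : R | 0 <= t]].

Section Straighten.
Variables (p : V -> R) (y : V).
Hypothesis sp : sublinear p.

Let straighten_lbound x :
  has_lbound [set p (x + t%:C *: y) - t * p y | t in [set t : R | 0 <= t]].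
Proof.
(* Subadditivity gives t * p y = p (t y) <= p (x + t y) + p (- x). *)
exists (- p (- x)) => _ [t /= t0 <-].
have := sp.1 (x + t%:C *: y) (- x); rewrite [x + _]addrC addrK.
suff -> : p (t%:C *: y) = t * p y by lra.
move: t0; rewrite le_eqVlt => /predU1P[<-|t0].
  by rewrite scale0r sublinear0// mul0r.
apply/eqP; rewrite eq_le sp.2//=.
have ti : 0 < t^-1 by rewrite invr_gt0.
have := sp.2 _ (t%:C *: y) ti; rewrite scalerA -rmorphM mulVf ?gt_eqF// scale1r.
by rewrite -ler_pdivrMl ?invrK.
Qed.

Lemma straighten_le t x : 0 <= t ->
  straighten p y x <= p (x + t%:C *: y) - t * p y.
Proof. by move=> t0; apply: ge_inf => //; exists t. Qed.

Lemma straighten_le_id x : straighten p y x <= p x.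
Proof. by have := straighten_le x (lexx 0); rewrite scale0r addr0 mul0r subr0. Qed.

Lemma straighten_sublinear : sublinear (straighten p y).
Proof.
apply: sublinear_inf => [|//|s t x z /= s0 t0|s t x /= s0 t0].
- by exists 0 => /=.
- exists (s + t); first exact: addr_ge0.
  have := sp.1 (x + s%:C *: y) (z + t%:C *: y).
  by rewrite addrACA -scalerDl -rmorphD/=; lra.
- exists (t * s); first by rewrite mulr_ge0// ltW.
  have := sp.2 t (x + s%:C *: y) t0.
  by rewrite scalerDr scalerA -rmorphM/=; lra.
Qed.

End Straighten.

Lemma minimal_sublinear p : sublinear p ->
  exists q, [/\ sublinear q, (forall x, q x <= p x) &
    forall r, sublinear r -> (forall x, r x <= q x) -> r = q].
Proof.
move=> sp; pose T := {q : V -> R | sublinear q /\ forall x, q x <= p x}.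
(* The order is reversed: a maximal element for [ge] is a minimal functional. *)
pose ge (q r : T) := `[< forall x, sval r x <= sval q x >].
have [||||[q [sq qp]] qmin] := @Zorn T ge.
- by move=> q; apply/asboolP.
- move=> q r s /asboolP qr /asboolP rs; apply/asboolP => x.
  exact: le_trans (rs x) (qr x).
- move=> [q hq] [r hr] /asboolP qr /asboolP rq; apply: eq_exist.
  by apply/funext => x; apply/le_anti; rewrite [X in X && _]rq; exact: qr.
- move=> A totA; have [->|/set0P[q0 Aq0]] := eqVneq A set0.
    by exists (exist _ p (conj sp (fun x => lexx (p x)))).
  have lbA x : has_lbound [set sval q x | q in A].
    exists (- p (- x)) => _ [q _ <-]; have [sq qp] := svalP q.
    by apply: le_trans (sublinearN x sq); rewrite lerN2.
  pose m x := inf [set sval q x | q in A].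
  have m_le (q : T) x : A q -> m x <= sval q x.
    by move=> Aq; apply: ge_inf => //; exists q.
  have sm : sublinear m.
    apply: sublinear_inf => [|//|q r x y Aq Ar|q t x Aq t0].
    - by exists q0.
    - have [qD _] := (svalP q).1; have [rD _] := (svalP r).1.
      (* The smaller of [q] and [r] serves as the index for x + y. *)
      have [/asboolP qr|/asboolP rq] := totA _ _ Aq Ar.
      + by exists r => //; apply: le_trans (rD x y) _; rewrite lerD2r.
      + by exists q => //; apply: le_trans (qD x y) _; rewrite lerD2l.
    - by exists q => //; exact: (svalP q).1.2.
  have mp x : m x <= p x by apply: le_trans (m_le _ x Aq0) _; exact: (svalP q0).2.
  by exists (exist _ m (conj sm mp)) => q Aq; apply/asboolP => x; exact: m_le.
- exists q; split=> // r sr rq.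
  have rp x : r x <= p x by apply: le_trans (rq x) _.
  apply: (congr1 sval (qmin (exist _ r (conj sr rp)) _)).
  exact/asboolP.
Qed.

Lemma real_hahn_banach p y : sublinear p ->
  exists f : V -> R, [/\ {morph f : x z / x + z},
    (forall t x, f (t%:C *: x) = t * f x), (forall x, f x <= p x) & f y = p y].
Proof.
(* Starting from [straighten p y] rather than [p] forces [f (- y) <= - p y]. *)
move=> sp; have [f [sf f_le fmin]] := minimal_sublinear (straighten_sublinear y sp).
have fD : {morph f : x z / x + z}.
  move=> x z; apply/le_anti; rewrite sf.1/=.
  (* Minimality forces [straighten f z] = f, so the bound at t = 1 is superadditivity: f x <= f (x +
     z) - f z. *)
  have : straighten f z x <= f (x + 1%:C *: z) - 1 * f z.
    exact: straighten_le.
  rewrite scale1r mul1r (fmin (straighten f z)).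
  - by lra.
  - exact: straighten_sublinear.
  - by move=> u; exact: straighten_le_id.
have fN x : f (- x) = - f x.
  by have := fD x (- x); rewrite subrr sublinear0//; lra.
have fZ_gt0 t x : 0 < t -> f (t%:C *: x) = t * f x.
  move=> t0; apply/le_anti; rewrite sf.2//=.
  by have := sf.2 t (- x) t0; rewrite scalerN !fN mulrN lerN2.
exists f; split=> //.
- move=> t x; have [t0|t0|->] := ltgtP t 0; last 1 first.
  + by rewrite scale0r mul0r sublinear0.
  + have := fZ_gt0 (- t) x; rewrite oppr_gt0 => /(_ t0).
    by rewrite rmorphN scaleNr fN mulNr => /oppr_inj.
  + exact: fZ_gt0.
- by move=> x; exact: le_trans (f_le x) (straighten_le_id y sp x).
- apply/le_anti/andP; split.
    exact: le_trans (f_le y) (straighten_le_id y sp y).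
  have := f_le (- y); have := straighten_le y sp (- y) ler01.
  by rewrite scale1r addNr sublinear0// fN mul1r; lra.
Qed.

(** Absolute values of complex scalars are elements of R[i]; [complex.Re] brings |a| back to R,
    where p takes its values. *)
Definition seminorm p : Prop :=
  (forall x y, p (x + y) <= p x + p y) /\
  (forall (a : R[i]) x, p (a *: x) <= complex.Re `|a| * p x).

(** A real-linear f <= p with f y = p y is the real part of the complex-linear g x = f x - i f (i
    x). Multiplying x by a scalar of modulus 1 turns Re g <= p into |g| <= p. *)
Lemma complex_hahn_banach p y : seminorm p ->
  exists f : {scalar V}, f y = (p y)%:C /\ forall x, `|f x| <= (p x)%:C.
Proof.
move=> [pD pZ].
have sp : sublinear p.
  by split=> // t x t0; have := pZ t%:C x; rewrite ger0_norm// ler0c ltW.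
have [f [fD fZ fp fy]] := real_hahn_banach y sp.
pose g x : R[i] := f x +i* - f ('i%C *: x).
have gD x z : g (x + z) = g x + g z.
  by rewrite /g scalerDr !fD opprD.
have fC a b x : f ((a +i* b) *: x) = a * f x + b * f ('i%C *: x).
  have -> : a +i* b = a%:C + b%:C * 'i%C by rewrite [LHS]complexE mulrC.
  by rewrite scalerDl -scalerA fD !fZ.
have gZ a x : g (a *: x) = a * g x.
  case: a => a b.
  have ia : 'i%C * (a +i* b) = (- b) +i* a.
    by apply/eqP; rewrite mulrC eq_complex ReiNIm ImiRe /= !eqxx.
  rewrite /g scalerA ia. rewrite (fC a) (fC (- b)). rewrite -[(a +i* b) * _]/((_ - _) +i* (_ + _)).
  congr (_ +i* _). 2:lra.  lra.
pose gL : {scalar V} := HB.pack g (GRing.isLinear.Build R[i] V R[i] _ g (fun a x z =>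
  etrans (gD (a *: x) z) (congr1 (+%R^~ (g z)) (gZ a x)))).
have Re_g x : complex.Re (g x) <= p x by exact: fp.
have g_le x : `|g x| <= (p x)%:C.
  have [->|gx0] := eqVneq (g x) 0.
    (* What remains is p x >= 0, which follows from - p x <= - p (- x) <= p x. *)
    rewrite normr0 ler0c.
    have := pZ (- 1) x; have := sublinearN x sp.
    by rewrite scaleN1r normrN1 mul1r; lra.
  pose c := `|g x| / g x.
  have c1 : `|c| = 1 by rewrite normf_div normr_id divff// normr_eq0.
  have gc : g (c *: x) = `|g x| by rewrite gZ divfK.
  have := Re_g (c *: x); rewrite gc => h.
  rewrite -(RRe_real (normr_real (g x))) lecR.
  apply: le_trans h _; apply: le_trans (pZ c x) _.
  by rewrite c1 mul1r.
exists gL; split=> //.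
(* As f y = p y, the bound (f y)^2 + (f (i y))^2 <= (p y)^2 forces f (i y) = 0. *)
have := g_le y; rewrite -(@ler_pXn2r _ 2)// ?nnegrE; last first.
  exact: le_trans (g_le y).
rewrite -add_Re2_Im2 -rmorphXn lecR/= fy gerDl sqrrN => fi0.
have : f ('i%C *: y) ^+ 2 == 0 by rewrite eq_le fi0 sqr_ge0.
by rewrite sqrf_eq0 /g => /eqP ->; rewrite fy oppr0.
Qed.

End HahnBanach.

(** * Distance to a closed subspace and separation of a point from it *)

Section Nest.
Variables (R : realType) (X : completeNormedModType R[i]).
Implicit Types (M K : set X) (x y : X).

(** Real-valued form of the norm, so that the infimum in [dist] is taken in R. *)
Let normX x : R := complex.Re `|x|.

Let normXE x : (normX x)%:C = `|x|.
Proof. exact: RRe_real (normr_real x). Qed.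

Let normX_ge0 x : 0 <= normX x.
Proof. by rewrite -ler0c normXE. Qed.

Let normXD x y : normX (x + y) <= normX x + normX y.
Proof. by rewrite -lecR rmorphD/= !normXE ler_normD. Qed.

Let normXZ (a : R[i]) x : normX (a *: x) = complex.Re `|a| * normX x.
Proof.
apply: complexI.
transitivity ((complex.Re `|a|)%:C * (normX x)%:C); last by rewrite -rmorphM.
by rewrite !normXE normrZ (RRe_real (normr_real a)).
Qed.

Definition dist M x : R := inf [set normX (x - m) | m in M].

Lemma dist_le M x m : M m -> dist M x <= normX (x - m).
Proof.
move=> Mm; apply: ge_inf; last by exists m.
by exists 0 => _ [? _ <-]; exact: normX_ge0.
Qed.

Lemma le_dist M x (a : R) : M !=set0 ->
  (forall m, M m -> a <= normX (x - m)) -> a <= dist M x.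
Proof.
move=> [m Mm] h; apply: lb_le_inf; first by exists (normX (x - m)), m.
by move=> _ [? ? <-]; exact: h.
Qed.

Lemma submod0 M : submod_closed [in M] -> M 0.
Proof. by move=> [/set_mem]. Qed.

Lemma submodD M x y : submod_closed [in M] -> M x -> M y -> M (x + y).
Proof.
move=> [_ h] Mx My; apply: set_mem; rewrite -[x]scale1r.
by apply: h; exact: mem_set.
Qed.

Lemma submodZ M (a : R[i]) x : submod_closed [in M] -> M x -> M (a *: x).
Proof.
move=> [M0 h] Mx; apply: set_mem; rewrite -[_ *: x]addr0.
by apply: h => //; exact: mem_set.
Qed.

Lemma dist_seminorm M : submod_closed [in M] -> seminorm (dist M).
Proof.
move=> sM; have M0 : M !=set0 by exists 0; exact: submod0.
split=> [x y|a x].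
  rewrite -lerBlDr; apply: le_dist => // m Mm.
  rewrite lerBlDr -lerBlDl; apply: le_dist => // n Mn.
  rewrite lerBlDl; apply: le_trans (dist_le _ (submodD sM Mm Mn)) _.
  by rewrite opprD addrACA; exact: normXD.
have distZ m : M m -> dist M (a *: x) <= complex.Re `|a| * normX (x - m).
  move=> Mm; rewrite -normXZ scalerBr; exact: dist_le (submodZ a sM Mm).
have : 0 <= complex.Re `|a| by rewrite -ler0c RRe_real// normr_real.
(* Dividing by |a| requires |a| > 0; for |a| = 0 the choice m = 0 already gives the bound. *)
rewrite le_eqVlt => /predU1P[a0|a0].
  by move: (distZ 0 (submod0 sM)); rewrite -a0 !mul0r.
rewrite -ler_pdivrMl//; apply: le_dist => // m Mm.
by rewrite ler_pdivrMl//; exact: distZ.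
Qed.

(** Since M is closed, some ball around y misses it, and the radius bounds the distance from
    below. *)
Lemma dist_gt0 M y : closed_subspace M -> ~ M y -> 0 < dist M y.
Proof.
move=> [cM sM] My.
have : nbhs y (~` M) by apply: open_nbhs_nbhs; split => //; exact: closed_openC.
move=> /nbhs_ballP[e /= e0 eM].
have eR : (complex.Re e)%:C = e by exact: RRe_real (gtr0_real e0).
apply: (@lt_le_trans _ _ (complex.Re e)); first by rewrite -ltcR eR.
apply: le_dist => [|m Mm]; first by exists 0; exact: submod0.
rewrite -lecR eR normXE (real_leNgt (gtr0_real e0) (normr_real _)).
apply/negP => h; apply: (eM m) => //.
by rewrite -ball_normE /ball_/=.
Qed.

(** Hahn-Banach for [dist M] gives f with |f x| <= dist M x, which vanishes on M and is at most |x|;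
    dividing by f y = dist M y > 0 normalises it. *)
Lemma closed_subspace_separation M y : closed_subspace M -> ~ M y ->
  exists f : {scalar X}, [/\ f y = 1, forall x, M x -> f x = 0 &
    exists c : R, forall x, `|f x| <= c%:C * `|x|].
Proof.
move=> cM My; have dy := dist_gt0 cM My; have [_ sM] := cM.
have [f [fy fle]] := complex_hahn_banach y (dist_seminorm sM).
have dy0 : (dist M y)%:C != 0 :> R[i] by rewrite gt_eqF// ltcR.
have f_le x : `|f x| <= `|x|.
  apply: le_trans (fle x) _; rewrite -normXE lecR.
  by have := dist_le x (submod0 sM); rewrite subr0.
pose g x : R[i] := ((dist M y)%:C)^-1 * f x.
have gL a x z : g (a *: x + z) = a * g x + g z.
  by rewrite /g linearP mulrDr mulrCA.
pose h : {scalar X} := HB.pack g (GRing.isLinear.Build R[i] X R[i] _ g gL).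
exists h; split => /=.
- by rewrite /g fy mulVf.
- move=> x Mx; rewrite /g.
  suff -> : f x = 0 by rewrite mulr0.
  apply/eqP; rewrite -normr_le0; apply: le_trans (fle x) _.
  rewrite lecR; have := dist_le x Mx.
  by rewrite subrr /normX normr0.
- exists (dist M y)^-1 => x; rewrite /g normrM fmorphV.
  by rewrite ler_pM// normfV ger0_norm// ler0c ltW.
Qed.

(** * Rank-one operators, joins, and reflexivity of nests *)

Let rank_one_linear (f : {scalar X}) x : linear (fun z => f z *: x).
Proof. by move=> a z w; rewrite linearP scalerDl scalerA. Qed.

Definition rank_one (f : {scalar X}) x : {linear X -> X} :=
  HB.pack (fun z => f z *: x)
    (GRing.isLinear.Build R[i] X X _ _ (rank_one_linear f x)).

Lemma rank_one_bounded (f : {scalar X}) x (c : R) :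
  (forall z, `|f z| <= c%:C * `|z|) -> bounded_operator (rank_one f x).
Proof.
move=> fc; exists (c * normX x) => z /=.
rewrite normrZ rmorphM [X in _ * X * _]normXE mulrAC.
by rewrite ler_wpM2r.
Qed.

Lemma subspace_join_ub (F : set (set X)) M : F M -> M `<=` subspace_join F.
Proof.
move=> FM x Mx; apply: subset_closure.
exists 1%N, (fun=> 1), (fun=> x); split; first by move=> _; exists M.
by rewrite big_ord1 scale1r.
Qed.

Lemma subspace_join_lub (F : set (set X)) M : closed_subspace M ->
  (forall K, F K -> K `<=` M) -> subspace_join F `<=` M.
Proof.
move=> [cM sM] FM; rewrite [X in _ `<=` X](closure_id M).1//.
apply: closureS => x [n [a [v [Fv ->]]]].
elim/big_ind : _ => [|u w|i _]; [exact: submod0|exact: submodD|].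
by have [K FK Kv] := Fv i; apply: submodZ => //; exact: FM Kv.
Qed.

(** With f = 0 on P and f y = 1, the condition on the K in N puts [rank_one f x] in [Alg N], and
    this operator sends y to x. *)
Lemma Lat_Alg_rank_one (N : set (set X)) M P y x :
  N `<=` closed_subspace (X := X) -> Lat (Alg N) M -> M y ->
  closed_subspace P -> ~ P y ->
  (forall K, N K -> K `<=` P \/ K x) -> M x.
Proof.
move=> Nsub [_ MAlg] My cP Py NPx.
have [f [fy fP [c fc]]] := closed_subspace_separation cP Py.
suff /MAlg : Alg N (rank_one f x).
  by apply; exists y => //=; rewrite fy scale1r.
split; first exact: rank_one_bounded fc.
move=> K NK _ [z Kz <-] /=; have [_ sK] := Nsub _ NK.
have [KP|Kx] := NPx _ NK; last exact: submodZ.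
by rewrite fP ?scale0r; [exact: submod0|exact: KP].
Qed.

Lemma nest_reflexive (N : set (set X)) : nest N -> Lat (Alg N) = N.
Proof.
move=> [[Nsub N0 NT Njoin Nmeet] Ntot]; apply/seteqP; split=> M; last first.
  by move=> NM; split=> [|A [_]]; [exact: Nsub|exact].
move=> LM; have [cM _] := LM.
have lt_le y K : M y -> N K -> ~ K y -> K `<=` M.
  (* Here P = K: by totality each L in N lies in K or contains K, hence x. *)
  move=> My NK Ky x Kx; apply: (Lat_Alg_rank_one Nsub LM My (Nsub _ NK) Ky).
  by move=> L NL; have [LK|KL] := Ntot _ _ NL NK; [left|right; exact: KL].
have meet_le y : M y -> subspace_meet [set K | N K /\ K y] `<=` M.
  move=> My; set P := subspace_join [set K | N K /\ ~ K y].
  have NP : N P by apply: Njoin => K [].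
  have PM : P `<=` M by apply: subspace_join_lub => // K [NK]; exact: lt_le.
  (* If y lies in P, then P is one of the subspaces in the meet, so the meet lies in P, hence in
     M. *)
  have [Py|Py] := pselect (P y); first by move=> x /(_ P (conj NP Py)) /PM.
  move=> x Nyx; apply: (Lat_Alg_rank_one Nsub LM My (Nsub _ NP) Py) => K NK.
  have [Ky|Ky] := pselect (K y); first by right; exact: Nyx (conj NK Ky).
  by left; exact: subspace_join_ub.
have -> : M = subspace_join [set K | N K /\ K `<=` M].
  apply/seteqP; split; last by apply: subspace_join_lub => // K [].
  (* The meet of the members of N containing y contains y, belongs to N and lies in M, so it is one
     of the joined subspaces. *)
  move=> y My; pose Ny := subspace_meet [set K | N K /\ K y].
  apply: (@subspace_join_ub _ Ny); last by move=> K [].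
  by split; [apply: Nmeet => K []|exact: meet_le].
by apply: Njoin => K [].
Qed.

End Nest.

Theorem theorem4 (R : realType) (X : completeNormedModType (complex R))
    (hX : dim_at_least X 2) (N : set (set X)) (hN : nest N) :
  Lat (Alg N) = N.
Proof. exact: nest_reflexive. Qed.
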